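(* Let $H$ be a locally compact topological group, $K$ a symmetric compact subset of $H$, $\Lambda$ a group, and $f:\Lambda\to(H:K)$ a quasi-homomorphism with $f(xy^{-1})\in f(x)f(y)^{-1}K$ for all $x,y\in\Lambda$. Then all sets $X=f^{-1}(UK)$, with $U$ a compact neighborhood of the identity in $H$, are right-commensurable to each other in $\Lambda$. Thus any symmetric set sandwiched (with respect to inclusion) between two such sets is an approximate subgroup. In particular, for each such $X$, the set $XX^{-1}$ is an approximate subgroup.
   Context: A subset $S$ of a group is symmetric if $1\in S=S^{-1}$. Two subsets are (right-)commensurable if each is covered by finitely many right translates of the other. A symmetric subset $S$ is an approximate subgroup if $S$ and $S^2$ are commensurable. A quasi-homomorphism $f:\Lambda\to(H:K)$ is a map $\Lambda\to H$ with $f(1)=1$ and $f(xy^{-1})\in f(x)f(y^{-1})K$ for all $x,y$. (The set $K$ is not assumed to be conjugation-invariant.) *)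

(* Defs.v *)
From HB Require Import structures.
From mathcomp Require Import all_boot.
From mathcomp Require Import boolp classical_sets functions cardinality.
From mathcomp Require Import topology.

Set Implicit Arguments.
Unset Strict Implicit.
Unset Printing Implicit Defensive.

Local Open Scope classical_set_scope.
Local Open Scope group_scope.

HB.structure Definition NbhsGroup := {G of Nbhs G & Group G}.

HB.structure Definition PreTopologicalGroup := {G of Topological G & Group G}.

HB.mixin Record PreTopologicalGroup_isTopologicalGroup G
    & PreTopologicalGroup G := {
  mulg_continuous : continuous (fun x : G * G => x.1 * x.2) ;
  invg_continuous : continuous (fun x : G => x^-1)
}.

(* As for TopologicalZmodule, the topology is not assumed to be Hausdorff. *)
#[short(type="topologicalGroupType")]
HB.structure Definition TopologicalGroup :=
  {G of PreTopologicalGroup G & PreTopologicalGroup_isTopologicalGroup G}.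

Section GroupSubsets.
Variable G : groupType.
Implicit Types (g : G) (A B S : set G).

Definition mulgs A B : set G := [set a * b | a in A & b in B].

Definition invgs A : set G := [set a^-1 | a in A].

Definition ltranslate g A : set G := [set g * a | a in A].

Definition rtranslate A g : set G := [set a * g | a in A].

Definition symmetric_subset S := S 1 /\ S = invgs S.

Definition covered_by_rtranslates A B :=
  exists2 D : set G, finite_set D & A `<=` \bigcup_(g in D) rtranslate B g.

Definition right_commensurable A B :=
  covered_by_rtranslates A B /\ covered_by_rtranslates B A.

Definition approximate_subgroup S :=
  symmetric_subset S /\ right_commensurable S (mulgs S S).

End GroupSubsets.

Definition quasi_homomorphism (L H : groupType) (K : set H) (f : L -> H) :=
  f 1 = 1 /\ forall x y, ltranslate (f x * f (y^-1)) K (f (x * y^-1)).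

Definition compact_nbhs1 (H : topologicalGroupType) (U : set H) :=
  compact U /\ nbhs (1 : H) U.

(* Main.v *)
Require Import Defs.
From HB Require Import structures.
From mathcomp Require Import all_boot.
From mathcomp Require Import boolp classical_sets functions cardinality.
From mathcomp Require Import topology.

Set Implicit Arguments.
Unset Strict Implicit.
Unset Printing Implicit Defensive.

Local Open Scope classical_set_scope.
Local Open Scope group_scope.

(** If [x] and [y] lie in [f^-1(W)] for a small [W] with [W W^-1] inside [V],
    then [f(x y^-1)] lies in [V K], that is, [x] lies in [f^-1(V K) y].  Since a
    compact [C] is covered by finitely many such [W], the preimage [f^-1(C)] is
    covered by finitely many right translates of [f^-1(V K)].  The products of
    two of the sets in question are mapped by [f] to a compact set again. *)

Section CoveringByTranslates.
Variable G : groupType.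
Implicit Types A B C : set G.

Lemma subset_covered_by_rtranslates A B :
  A `<=` B -> covered_by_rtranslates A B.
Proof.
move=> AB; exists [set 1]; first exact: finite_set1.
by move=> a Aa; exists 1 => //; exists a; rewrite ?mulg1//; exact: AB.
Qed.

Lemma covered_by_rtranslatesS A A' B B' : A' `<=` A -> B `<=` B' ->
  covered_by_rtranslates A B -> covered_by_rtranslates A' B'.
Proof.
move=> A'A BB' [D finD AD]; exists D => // a /A'A/AD[g Dg [b Bb <-]].
by exists g => //; exists b => //; exact: BB'.
Qed.

Lemma symmetric_mulgs_invgs A : A 1 -> symmetric_subset (mulgs A (invgs A)).
Proof.
move=> A1; split.
  by exists 1 => //; exists 1; rewrite ?mulg1//; exists 1; rewrite ?invg1.
have sub x : mulgs A (invgs A) x -> mulgs A (invgs A) x^-1.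
  move=> [a Aa [_ [b Ab <-] <-]]; exists b => //; exists a^-1; first by exists a.
  by rewrite invgM invgK.
apply/seteqP; split=> [x /sub xS|_ [x /sub xS <-]//].
by exists x^-1 => //; rewrite invgK.
Qed.

End CoveringByTranslates.

Section TopologicalGroup.
Variable H : topologicalGroupType.
Implicit Types A B C V : set H.

Lemma compact_mulgs A B : compact A -> compact B -> compact (mulgs A B).
Proof.
move=> cA cB; rewrite /mulgs image2E.
apply: continuous_compact; last exact: compact_setX.
apply: continuous_subspaceT; rewrite (_ : uncurry _ = fun x : H * H => x.1 * x.2).
  exact: mulg_continuous.
by apply/funext => -[].
Qed.

Lemma compact_invgs A : compact A -> compact (invgs A).
Proof.
move=> cA; apply: continuous_compact => //; apply: continuous_subspaceT.
exact: invg_continuous.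
Qed.

(** The map sending [(x, y)] to [x * y^-1] is continuous and has value 1 at [(h, h)], so it sends a
    box around [(h, h)] into [V]. Intersecting the two sides of the box gives [W]. *)
Lemma nbhs_divg V (h : H) : nbhs (1 : H) V ->
  exists2 W, nbhs h W & forall x y, W x -> W y -> V (x * y^-1).
Proof.
move=> V1.
have cvgV : (fun p : H * H => p.1 * p.2^-1) @ nbhs (h, h) --> (1 : H).
  rewrite -(mulgV h).
  apply: (@continuous2_cvg _ _ _ _ _ _ fst (fun p : H * H => p.2^-1)).
  - exact: (@mulg_continuous H (h, h^-1)).
  - exact: cvg_fst.
  - by apply: (@cvg_comp _ _ _ snd _ _ (nbhs h));
      [exact: cvg_snd | exact: invg_continuous].
have [[A B] [/= Ah Bh] ABV] := cvgV _ V1.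
exists (A `&` B); first exact: filterI.
by move=> x y [Ax _] [_ By]; exact: (ABV (x, y)).
Qed.

End TopologicalGroup.

Section QuasiHomomorphism.
Variables (H : topologicalGroupType) (L : groupType) (K : set H) (f : L -> H).
Hypothesis f_div : forall x y, ltranslate (f x * (f y)^-1) K (f (x * y^-1)).

Lemma preimage_compact_covered C V : compact C -> nbhs (1 : H) V ->
  covered_by_rtranslates (f @^-1` C) (f @^-1` mulgs V K).
Proof.
move=> /compact_near_coveringP cC V1.
(* [near_covering] replaces finite subcovers, which the library provides only
   for pointed spaces: "near [F]" means "for all large enough finite sets". *)
pose F := filter_from (@finite_set L) (fun D => [set E | D `<=` E]).
have FF : Filter F.
  apply: filter_from_filter; first by exists set0.
  move=> D D' finD finD'; exists (D `|` D'); first by rewrite finite_setU.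
  by move=> E; rewrite /= subUset.
(* A near covering needs a condition on points of [H]: here the translates by [D] cover the whole
   fibre of [f] over [h]. *)
pose P (D : set L) h := forall x, f x = h ->
  (\bigcup_(g in D) rtranslate (f @^-1` mulgs V K) g) x.
have [h Ch|D finD DP] := cC _ F P FF; last first.
  by exists D => // x Cfx; exact: (DP D (@subset_refl _ D) (f x) Cfx x).
have [W Wh WV] := nbhs_divg h V1.
(* The single translate by [y] will cover the whole preimage of [W]. If that preimage is empty, [y]
   is the default 1 and there is nothing to cover. *)
pose y := xget 1 (f @^-1` W).
exists (W, [set E | [set y] `<=` E]).
  by split=> //; exists [set y] => //; exact: finite_set1.
move=> [h' E] /= [Wh' yE] x fxE.
have Wfx : W (f x) by rewrite fxE.
have Wfy : W (f y) by apply: (@xgetPex _ 1 (f @^-1` W)); exists x.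
have [k Kk fk] := f_div x y.
exists y; first exact: yE.
exists (x * y^-1); last by rewrite mulgVK.
by exists (f x * (f y)^-1); [exact: WV | exists k].
Qed.

Lemma mulgs_preimage_subset A C :
  mulgs (f @^-1` A) (invgs (f @^-1` C)) `<=`
  f @^-1` mulgs (mulgs A (invgs C)) K.
Proof.
move=> _ [x Ax [_ [y Cy <-] <-]]; have [k Kk fk] := f_div x y.
exists (f x * (f y)^-1); last by exists k.
by exists (f x) => //; exists (f y)^-1 => //; exists (f y).
Qed.

(** By symmetry the square of [S] is [S S^-1], which [f] maps into the compact set [C C^-1 K].
    Finitely many translates of the preimage of [V K], hence of [S], therefore cover it. Allowing
    any compact [C] as upper bound makes the lemma apply directly to [X X^-1]. *)
Lemma approximate_subgroup_sandwich C V (S : set L) :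
  compact K -> compact C -> nbhs (1 : H) V -> symmetric_subset S ->
  f @^-1` mulgs V K `<=` S -> S `<=` f @^-1` C -> approximate_subgroup S.
Proof.
move=> cK cC V1 S_sym VS SC; split=> //; split.
  apply: subset_covered_by_rtranslates => x Sx.
  by exists x => //; exists 1; rewrite ?mulg1//; case: S_sym.
have cCCK : compact (mulgs (mulgs C (invgs C)) K).
  by apply: compact_mulgs => //; apply: compact_mulgs => //; exact: compact_invgs.
apply: covered_by_rtranslatesS VS (preimage_compact_covered cCCK V1).
apply: subset_trans (@mulgs_preimage_subset C C).
(* Only the second factor of the product is turned into [invgs S]. *)
rewrite {2}(proj2 S_sym) => _ [x /SC Cx [_ [y /SC Cy <-] <-]].
by exists x => //; exists y^-1 => //; exists y.
Qed.

End QuasiHomomorphism.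

Theorem proposition5p12 (H : topologicalGroupType)
    (H_lc : locally_compact [set: H])
    (K : set H) (K_sym : symmetric_subset K) (K_compact : compact K)
    (L : groupType) (f : L -> H) (f_qhom : quasi_homomorphism K f)
    (f_div : forall x y : L, ltranslate (f x * (f y)^-1) K (f (x * y^-1))) :
  [/\ forall U V : set H, compact_nbhs1 U -> compact_nbhs1 V ->
        right_commensurable (f @^-1` mulgs U K) (f @^-1` mulgs V K),
      forall (U V : set H) (S : set L), compact_nbhs1 U -> compact_nbhs1 V ->
        symmetric_subset S ->
        f @^-1` mulgs U K `<=` S -> S `<=` f @^-1` mulgs V K ->
        approximate_subgroup S
    & forall U : set H, compact_nbhs1 U ->
        approximate_subgroup
          (mulgs (f @^-1` mulgs U K) (invgs (f @^-1` mulgs U K)))].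
Proof.
have cVK V : compact_nbhs1 V -> compact (mulgs V K).
  by case=> cV _; exact: compact_mulgs.
split.
(* Each covering uses compactness of the set to be covered, before preimages, and the neighborhood
   inside the other one. *)
- move=> U V cU cV; split; apply: preimage_compact_covered => //.
  + exact: cVK.
  + by case: cV.
  + exact: cVK.
  + by case: cU.
- move=> U V S [_ U1] /cVK cV S_sym US SV.
  exact: approximate_subgroup_sandwich cV U1 S_sym US SV.
- move=> U cU; have [_ U1] := cU.
  (* This gives both [X] inside [X X^-1], the lower bound of the sandwich, and the symmetry of
     [X X^-1]. *)
  have X1 : (f @^-1` mulgs U K) 1.
    exists 1; first exact: nbhs_singleton.
    by exists 1; [case: K_sym | rewrite mulg1; case: f_qhom].
  have cC : compact (mulgs (mulgs (mulgs U K) (invgs (mulgs U K))) K).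
    apply: compact_mulgs => //.
    by apply: compact_mulgs; [|apply: compact_invgs]; exact: cVK.
  apply: (approximate_subgroup_sandwich f_div K_compact cC U1).
  + exact: symmetric_mulgs_invgs.
  + move=> x Xx; exists x => //; exists 1; rewrite ?mulg1//.
    by exists 1; rewrite ?invg1.
  + exact: mulgs_preimage_subset.
Qed.
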